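(* Let $p=3$, let $X=(X_1,X_2,X_3)\in\mathbb{R}^{n\times3}$ be a fair design with $X_1^TX_2=-\hat\rho$, $0<\hat\rho<1$, $\hat\varphi^2:=1-\hat\rho$, and let $\beta^0\in\mathbb{R}^3$ have active set $S_0=\{1,2\}$ (so $\beta_3^0=0$, $s_0=2$). Suppose that $$X_3=C(X_1+X_2)/2+U,$$ where $C$ is a constant satisfying $C>1$ and $C^2\hat\varphi^2/2<1$, and $U$ is a vector with $U^T(X_1,X_2)=0$. Define $\hat\tau^2:=1-C^2\hat\varphi^2/2$. Then $$\hat\phi^2(S_0)=\hat\varphi^2\hat\tau^2,\qquad\hat\Gamma^2(S_0)=\frac{s_0}{\hat\phi^2(S_0)}=\frac{2}{\hat\varphi^2}+\frac{C^2}{\hat\tau^2}.$$ For $\lambda>0$ and $\beta_1^0\ge\beta_2^0\ge\lambda/\hat\varphi^2+\lambda C(C-1)/(2\hat\tau^2)$, the noiseless Lasso $\beta^*$ satisfies $$\|X(\beta^*-\beta^0)\|_2^2+2\lambda\|\beta_{-S_0}^*\|_1=\frac{\lambda^2s_0}{\hat\phi^2(S_0)}-\frac{\lambda^2}{\hat\tau^2}.$$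
   Context: Fair design: all columns satisfy $\|X_j\|_2=1$ and there are no $j\ne k$ and constant $b$ with $X_j=bX_k$. The noiseless Lasso is $\beta^*:=\arg\min_{\beta\in\mathbb{R}^p}\{\|X(\beta-\beta^0)\|_2^2+2\lambda\|\beta\|_1\}$. For $S\subset\{1,\ldots,p\}$, $\beta_S$ is the vector with entries $\beta_j$ for $j\in S$ and $0$ otherwise, and $\beta_{-S}:=\beta_{S^c}$. The compatibility constant is $\hat\phi^2(S):=\min\{|S|\,\|X\beta\|_2^2:\ \|\beta_S\|_1=1,\ \|\beta_{-S}\|_1\le1\}$, and the effective sparsity is $\hat\Gamma^2(S):=|S|/\hat\phi^2(S)$. *)

(* Defs.v *)
From mathcomp Require Import all_boot all_order all_algebra.
From mathcomp Require Import boolp classical_sets reals.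

Set Implicit Arguments.
Unset Strict Implicit.
Unset Printing Implicit Defensive.

Import Order.TTheory GRing.Theory Num.Theory.

Local Open Scope ring_scope.

Section Norms.
Context {R : realType}.

Definition l1norm {n : nat} (v : 'cV[R]_n) : R := \sum_(i < n) `|v i 0|.

(* The norm that MathComp-Analysis puts on matrices is the sup norm, hence
   this definition. *)
Definition l2norm {n : nat} (v : 'cV[R]_n) : R :=
  Num.sqrt (\sum_(i < n) v i 0 ^+ 2).

(* The least element of A, with the junk value 0 when A has none; unlike [inf],
   [set_min A = m] with [m != 0] entails that the minimum is attained. *)
Definition set_min (A : set R) : R := xget 0 (fun m => A m /\ lbound A m).

Lemma set_minE (A : set R) (m : R) : A m -> lbound A m -> set_min A = m.
Proof.
move=> Am lbm; apply: xget_unique => // y [Ay lby].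
by apply/eqP; rewrite eq_le lby//= lbm.
Qed.

Lemma set_minP (A : set R) : set_min A != 0 ->
  A (set_min A) /\ lbound A (set_min A).
Proof. by rewrite /set_min; case: xgetP => [x _ //|_]; rewrite eqxx. Qed.

End Norms.

Section Lasso.
Context {R : realType} {n p : nat}.
Implicit Types (X : 'M[R]_(n, p)) (beta : 'cV[R]_p) (S : {set 'I_p}).

Definition fair_design X : Prop :=
  (forall j, l2norm (col j X) = 1) /\
  ~ (exists (j k : 'I_p) (b : R), j != k /\ col j X = b *: col k X).

Definition active_set beta : {set 'I_p} := [set j | beta j 0 != 0].

(* beta_S; the vector beta_{-S} is [subvec (~: S) beta]. *)
Definition subvec S beta : 'cV[R]_p :=
  \col_j (if j \in S then beta j 0 else 0).

Definition lasso_objective X (beta0 : 'cV[R]_p) (lambda : R) beta : R :=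
  l2norm (X *m (beta - beta0)) ^+ 2 + 2 * lambda * l1norm beta.

(* betas belongs to the arg min defining the noiseless Lasso. *)
Definition noiseless_lasso X (beta0 : 'cV[R]_p) (lambda : R)
    (betas : 'cV[R]_p) : Prop :=
  forall beta,
    lasso_objective X beta0 lambda betas <= lasso_objective X beta0 lambda beta.

(* The squared constants hat phi^2(S) and hat Gamma^2(S). *)
Definition compatibility2 X S : R :=
  set_min (fun r : R => exists beta : 'cV[R]_p,
    [/\ l1norm (subvec S beta) = 1, l1norm (subvec (~: S) beta) <= 1
      & r = #|S|%:R * l2norm (X *m beta) ^+ 2]).

Definition effective_sparsity2 X S : R := #|S|%:R / compatibility2 X S.

End Lasso.

(* Main.v *)
(** Diagonalising the Gram matrix gives, with phi = varphi2 and tau = tau2,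
    ||X b||^2 = (1 + rho)/2 (b_1 - b_2)^2 + phi/2 (b_1 + b_2 + C b_3)^2
                + tau b_3^2.
    For fixed u = b_1 + b_2 the last two terms are at least phi tau u^2 / 2,
    with equality at b_3 = - C phi u / 2, while the first one is at least
    phi tau (b_1 - b_2)^2 / 2. Since |b_1| + |b_2| is the maximum of
    |b_1 + b_2| and |b_1 - b_2|, this gives the compatibility constant.

    For the Lasso, the hypothesis on beta0 is exactly what makes the solution
    of the KKT equations X^T X (b - beta0) = - lambda (1, 1, 1)^T nonnegative.
    If b' denotes this solution, the objective at b exceeds that at b' by
    ||X (b - b')||^2 + 2 lambda (||b||_1 - sum_j b_j), so b' is the unique
    minimiser. *)

Require Import Defs.
From mathcomp Require Import all_boot all_order all_algebra.
From mathcomp Require Import boolp classical_sets reals.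
From mathcomp Require Import ring lra.

Import Order.TTheory GRing.Theory Num.Theory.

Local Open Scope ring_scope.

Lemma sum_ord3 (V : nmodType) (F : 'I_3 -> V) :
  \sum_(i < 3) F i = F 0 + F 1 + F 2.
Proof.
rewrite !big_ord_recl big_ord0 addr0 addrA.
by congr (_ + F _ + F _); apply: val_inj.
Qed.

Lemma sqr_l2norm (R : realType) (n : nat) (v : 'cV[R]_n) :
  l2norm v ^+ 2 = \sum_(i < n) v i 0 ^+ 2.
Proof. by rewrite sqr_sqrtr // sumr_ge0 // => i _; apply: sqr_ge0. Qed.

Lemma l1norm3 (R : realType) (v : 'cV[R]_3) :
  l1norm v = `|v 0 0| + `|v 1 0| + `|v 2 0|.
Proof. exact: sum_ord3. Qed.

Lemma l1norm_subvec01 (R : realType) (v : 'cV[R]_3) :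
  l1norm (subvec [set 0; 1]%SET v) = `|v 0 0| + `|v 1 0|.
Proof. by rewrite l1norm3 !mxE !inE /= normr0 addr0. Qed.

Lemma l1norm_subvecC01 (R : realType) (v : 'cV[R]_3) :
  l1norm (subvec (~: [set 0; 1]%SET) v) = `|v 2 0|.
Proof. by rewrite l1norm3 !mxE !inE /= normr0 !add0r. Qed.

Lemma norm_add_case (R : realDomainType) (x y : R) :
  `|x| + `|y| = `|x + y| \/ `|x| + `|y| = `|x - y|.
Proof.
case: (ger0P x) => hx; case: (ger0P y) => hy.
- by left; rewrite ger0_norm //; lra.
- by right; rewrite ger0_norm //; lra.
- by right; rewrite ltr0_norm //; lra.
- by left; rewrite ltr0_norm //; lra.
Qed.

(** The squared norm of [X *m beta] in diagonal form, as a function of the coordinates x, y, t of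
    [beta]; the coefficient of t^2 is the squared norm of [U]. *)
Definition diag_form {R : realType} (rho C x y t : R) : R :=
  (1 + rho) / 2 * (x - y) ^+ 2 + (1 - rho) / 2 * (x + y + C * t) ^+ 2
  + (1 - C ^+ 2 * (1 - rho) / 2) * t ^+ 2.

Lemma sqr_l2norm_mulmx3 (R : realType) (n : nat) (X : 'M[R]_(n, 3))
    (U : 'cV[R]_n) (rho C : R) (beta : 'cV[R]_3) :
  (forall j, l2norm (col j X) = 1) ->
  (col 0 X)^T *m col 1 X = (- rho)%:M ->
  col 2 X = (C / 2) *: (col 0 X + col 1 X) + U ->
  U^T *m row_mx (col 0 X) (col 1 X) = 0 ->
  l2norm (X *m beta) ^+ 2 = diag_form rho C (beta 0 0) (beta 1 0) (beta 2 0).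
Proof.
move=> unitX dot01 X2E Uorth.
have E2 i : X i 2 = C / 2 * (X i 0 + X i 1) + U i 0.
  by have := congr1 (fun A : 'cV_n => A i 0) X2E; rewrite !mxE.
have sq j : \sum_i X i j ^+ 2 = 1.
  have := congr1 (fun x => x ^+ 2) (unitX j).
  rewrite sqr_l2norm expr1n => <-.
  by apply: eq_bigr => i _; rewrite mxE.
have s01 : \sum_i X i 0 * X i 1 = - rho.
  have := congr1 (fun A : 'M_1 => A 0 0) dot01.
  rewrite !mxE eqxx mulr1n => <-.
  by apply: eq_bigr => i _; rewrite !mxE.
move: Uorth; rewrite mul_mx_row -row_mx0 => /eq_row_mx [U0 U1].
have sU0 : \sum_i U i 0 * X i 0 = 0.
  have := congr1 (fun A : 'M_1 => A 0 0) U0; rewrite !mxE => U0E.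
  by rewrite -[RHS]U0E; apply: eq_bigr => i _; rewrite !mxE.
have sU1 : \sum_i U i 0 * X i 1 = 0.
  have := congr1 (fun A : 'M_1 => A 0 0) U1; rewrite !mxE => U1E.
  by rewrite -[RHS]U1E; apply: eq_bigr => i _; rewrite !mxE.
(* Only the products of the columns 0 and 1 with each other survive, [U] being orthogonal to
   both. *)
have expand a b t : \sum_i (a * X i 0 + b * X i 1 + t * U i 0) ^+ 2
    = a ^+ 2 + b ^+ 2 - 2 * rho * a * b + t ^+ 2 * \sum_i U i 0 ^+ 2.
  have -> : a ^+ 2 + b ^+ 2 - 2 * rho * a * b + t ^+ 2 * \sum_i U i 0 ^+ 2
    = a ^+ 2 * (\sum_i X i 0 ^+ 2) + b ^+ 2 * (\sum_i X i 1 ^+ 2)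
      + 2 * a * b * (\sum_i X i 0 * X i 1) + 2 * a * t * (\sum_i U i 0 * X i 0)
      + 2 * b * t * (\sum_i U i 0 * X i 1) + t ^+ 2 * \sum_i U i 0 ^+ 2.
    by rewrite !sq s01 sU0 sU1; ring.
  rewrite !mulr_sumr -!big_split; apply: eq_bigr => i _ /=; ring.
(* The squared norm of [U] is forced by the unit norm of the column 2, which is [expand] at a = b =
   C / 2, t = 1. *)
have sU : \sum_i U i 0 ^+ 2 = 1 - C ^+ 2 * (1 - rho) / 2.
  have : \sum_i (C / 2 * X i 0 + C / 2 * X i 1 + 1 * U i 0) ^+ 2 = 1.
    rewrite -[RHS](sq 2); apply: eq_bigr => i _; rewrite E2; congr (_ ^+ 2); ring.
  rewrite expand => h; lra.
rewrite sqr_l2norm.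
transitivity (\sum_i ((beta 0 0 + C / 2 * beta 2 0) * X i 0
   + (beta 1 0 + C / 2 * beta 2 0) * X i 1 + beta 2 0 * U i 0) ^+ 2).
  apply: eq_bigr => i _; rewrite mxE sum_ord3 E2; congr (_ ^+ 2); ring.
by rewrite expand sU /diag_form; field.
Qed.

Lemma compatibility_lower_bound (R : realType) (rho C x y t : R) :
  0 < rho < 1 -> C ^+ 2 * (1 - rho) / 2 < 1 ->
  `|x| + `|y| = 1 ->
  (1 - rho) * (1 - C ^+ 2 * (1 - rho) / 2) <= 2 * diag_form rho C x y t.
Proof.
move=> /andP[rho0 rho1] hC2 xy1.
have [phi phiE] : {phi | phi = 1 - rho} by exists (1 - rho).
rewrite -phiE in hC2 *.
have [tau tauE] : {tau | tau = 1 - C ^+ 2 * phi / 2} by eexists.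
rewrite -tauE.
have phi0 : 0 < phi by lra.
have tau0 : 0 < tau by lra.
have tau1 : tau <= 1.
  by have := mulr_ge0 (sqr_ge0 C) (ltW phi0); lra.
(* After the square in t is completed, (x + y)^2 and (x - y)^2 both have a coefficient at least phi
   tau, and one of these two squares is 1. *)
have phitau : phi * tau <= 1 + rho.
  have : phi * tau <= phi * 1 by apply: ler_wpM2l; first exact: ltW.
  lra.
have -> : 2 * diag_form rho C x y t = phi * tau * (x + y) ^+ 2
    + (1 + rho) * (x - y) ^+ 2 + 2 * (t + C * phi * (x + y) / 2) ^+ 2.
  by rewrite /diag_form tauE phiE; field.
have e1 : 1 = (`|x| + `|y|) ^+ 2 by rewrite xy1 expr1n.
have ph0 := mulr_gt0 phi0 tau0.
have s1 := mulr_ge0 (ltW ph0) (sqr_ge0 (x + y)).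
have s2 := sqr_ge0 (t + C * phi * (x + y) / 2).
have s3 : 0 <= (1 + rho) * (x - y) ^+ 2 by rewrite mulr_ge0 ?sqr_ge0; lra.
case: (norm_add_case _ x y) => h; rewrite h real_normK ?num_real // in e1.
- rewrite -e1 mulr1 in s1 *; lra.
- rewrite -e1 mulr1 in s3 *; lra.
Qed.

Lemma compatibility_attained (R : realType) (rho C : R) :
  2 * diag_form rho C (1 / 2) (1 / 2) (- (C * (1 - rho) / 2))
  = (1 - rho) * (1 - C ^+ 2 * (1 - rho) / 2).
Proof. by rewrite /diag_form; field. Qed.

Lemma diag_form_ge0 (R : realType) (rho C x y t : R) :
  0 < rho < 1 -> C ^+ 2 * (1 - rho) / 2 < 1 -> 0 <= diag_form rho C x y t.
Proof.
move=> /andP[rho0 rho1] hC2.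
by rewrite /diag_form !addr_ge0 // mulr_ge0 ?sqr_ge0 //; lra.
Qed.

(** Positive definiteness, which yields uniqueness of the Lasso solution: each of the three
    nonnegative terms must vanish. *)
Lemma diag_form_eq0 (R : realType) (rho C x y t : R) :
  0 < rho < 1 -> C ^+ 2 * (1 - rho) / 2 < 1 -> diag_form rho C x y t <= 0 ->
  [/\ x = 0, y = 0 & t = 0].
Proof.
move=> /andP[rho0 rho1] hC2; rewrite /diag_form => q0.
have a1 : 0 < (1 + rho) / 2 by lra.
have a2 : 0 < (1 - rho) / 2 by lra.
have a3 : 0 < 1 - C ^+ 2 * (1 - rho) / 2 by lra.
have z (a b : R) : 0 < a -> a * b ^+ 2 <= 0 -> b = 0.
  move=> a0; rewrite pmulr_rle0 // => b0.
  by apply/eqP; rewrite -sqrf_eq0 eq_le b0 sqr_ge0.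
have s1 := mulr_ge0 (ltW a1) (sqr_ge0 (x - y)).
have s2 := mulr_ge0 (ltW a2) (sqr_ge0 (x + y + C * t)).
have s3 := mulr_ge0 (ltW a3) (sqr_ge0 t).
have t0 : t = 0 by apply: z a3 _; lra.
have xy : x - y = 0 by apply: z a1 _; lra.
have xyt : x + y + C * t = 0 by apply: z a2 _; lra.
by rewrite t0 mulr0 in xyt; split; lra.
Qed.

(* [d], [d] and [t0] solve the KKT equations for the signs (1, 1, 1). *)
Lemma diag_form_kkt_shift (R : realType) (rho C lambda phi tau d t0 : R) :
  phi = 1 - rho -> tau = 1 - C ^+ 2 * phi / 2 -> phi != 0 -> tau != 0 ->
  d = - (lambda / phi + lambda * C * (C - 1) / (2 * tau)) ->
  t0 = lambda * (C - 1) / tau ->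
  forall x y t, diag_form rho C x y t + 2 * lambda * (x + y + t)
  = diag_form rho C d d t0 + 2 * lambda * (d + d + t0)
    + diag_form rho C (x - d) (y - d) (t - t0).
Proof.
move=> phiE tauE phiN0 tauN0 dE t0E x y t; rewrite /diag_form -phiE -tauE.
(* The KKT equations in diagonal coordinates; they cancel the first-order part of the expansion
   around (d, d, t0). *)
have tau_t0 : tau * t0 = lambda * (C - 1) by rewrite t0E; field.
have phid : phi * (d + d + C * t0) = - 2 * lambda.
  by rewrite dE t0E; field; rewrite phiN0 tauN0.
apply/eqP; rewrite -subr_eq0; apply/eqP.
transitivity ((phi * (d + d + C * t0) + 2 * lambda) *
    (x + y + C * t - (d + d + C * t0))
  + 2 * (tau * t0 - lambda * (C - 1)) * (t - t0)); first by field.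
by rewrite phid tau_t0; ring.
Qed.

(** The form equals 2 lambda^2 / phi + lambda^2 (C - 1)^2 / tau here, and (C - 1)^2 + 2 (C - 1) =
    C^2 - 1 accounts for the subtracted term. *)
Lemma diag_form_kkt_value (R : realType) (rho C lambda phi tau d t0 : R) :
  phi = 1 - rho -> tau = 1 - C ^+ 2 * phi / 2 -> phi != 0 -> tau != 0 ->
  d = - (lambda / phi + lambda * C * (C - 1) / (2 * tau)) ->
  t0 = lambda * (C - 1) / tau ->
  diag_form rho C d d t0 + 2 * lambda * t0
  = lambda ^+ 2 * (2 / phi + C ^+ 2 / tau) - lambda ^+ 2 / tau.
Proof.
move=> phiE tauE phiN0 tauN0 -> ->; rewrite /diag_form -phiE -tauE.
by field; rewrite ?phiN0 ?tauN0.
Qed.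

(* The columns X_1, X_2, X_3 have the indices 0, 1, 2 in 'I_3. *)
Theorem lemma9p1 (R : realType) (n : nat) (X : 'M[R]_(n, 3))
    (beta0 : 'cV[R]_3) (S0 : {set 'I_3}) (U : 'cV[R]_n)
    (rho varphi2 C tau2 : R)
    (hfair : fair_design X)
    (hrho : (col 0 X)^T *m col 1 X = (- rho)%:M)
    (hrho01 : 0 < rho < 1)
    (hvarphi2 : varphi2 = 1 - rho)
    (hS0 : S0 = [set 0; 1]%SET)
    (hactive : active_set beta0 = S0)
    (hX3 : col 2 X = (C / 2) *: (col 0 X + col 1 X) + U)
    (hC : 1 < C)
    (hC2 : C ^+ 2 * varphi2 / 2 < 1)
    (hU : U^T *m row_mx (col 0 X) (col 1 X) = 0)
    (htau2 : tau2 = 1 - C ^+ 2 * varphi2 / 2) :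
  [/\ compatibility2 X S0 = varphi2 * tau2,
      effective_sparsity2 X S0 = #|S0|%:R / compatibility2 X S0,
      #|S0|%:R / compatibility2 X S0 = 2 / varphi2 + C ^+ 2 / tau2
    & forall lambda : R, 0 < lambda ->
        beta0 1 0 <= beta0 0 0 ->
        lambda / varphi2 + lambda * C * (C - 1) / (2 * tau2) <= beta0 1 0 ->
        (exists betas : 'cV[R]_3, noiseless_lasso X beta0 lambda betas) /\
        (forall betas : 'cV[R]_3, noiseless_lasso X beta0 lambda betas ->
           l2norm (X *m (betas - beta0)) ^+ 2
             + 2 * lambda * l1norm (subvec (~: S0) betas)
           = lambda ^+ 2 * #|S0|%:R / compatibility2 X S0
             - lambda ^+ 2 / tau2)].
Proof.
have [unitX _] := hfair.
have normE beta := sqr_l2norm_mulmx3 _ _ _ _ _ _ beta unitX hrho hX3 hU.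
clear hX3 hU hrho hfair unitX.
have [rho0 rho1] := andP hrho01.
have cardS0 : #|S0| = 2%N by rewrite hS0 cards2.
have phi0 : 0 < varphi2 by lra.
have tau0 : 0 < tau2 by lra.
have phiN0 : varphi2 != 0 by rewrite gt_eqF.
have tauN0 : tau2 != 0 by rewrite gt_eqF.
have compatE : compatibility2 X S0 = varphi2 * tau2.
  rewrite /compatibility2 cardS0 hS0; apply: set_minE.
  - exists (\col_j (if j == 2 then - (C * (1 - rho) / 2) else 1 / 2)); split.
    + by rewrite l1norm_subvec01 !mxE /= ger0_norm ?divr_ge0 //; field.
    (* Feasibility of the third entry: C > 1 gives C varphi2 / 2 <= C^2 varphi2 / 2 < 1. *)
    + have Cphi0 : 0 <= C * varphi2 by rewrite mulr_ge0; lra.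
      rewrite l1norm_subvecC01 !mxE /= normrN -hvarphi2 ger0_norm; last lra.
      have : 0 <= C * varphi2 * (C - 1) by rewrite mulr_ge0 //; lra.
      lra.
    + rewrite normE !mxE /= compatibility_attained htau2 hvarphi2 //.
  - move=> _ [beta [b1 _ ->]]; rewrite normE htau2 hvarphi2.
    apply: compatibility_lower_bound => //; first by rewrite -hvarphi2.
    by rewrite -l1norm_subvec01.
have ratioE : #|S0|%:R / compatibility2 X S0 = 2 / varphi2 + C ^+ 2 / tau2.
  rewrite compatE cardS0.
  (* The numerator is 2 by the definition of [tau2], and the fraction then splits. *)
  transitivity ((2 * tau2 + C ^+ 2 * varphi2) / (varphi2 * tau2)).
    by congr (_ / _); rewrite htau2; field.
  by field; rewrite ?phiN0 ?tauN0.
split => // lambda lambda0 b01 b1.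
have hC2' : C ^+ 2 * (1 - rho) / 2 < 1 by rewrite -hvarphi2.
have [d dE] : {d | d = - (lambda / varphi2 + lambda * C * (C - 1) / (2 * tau2))}
  by eexists.
have [t0 t0E] : {t | t = lambda * (C - 1) / tau2} by eexists.
have shiftE :=
  diag_form_kkt_shift _ _ _ _ _ _ _ _ hvarphi2 htau2 phiN0 tauN0 dE t0E.
have valueE :=
  diag_form_kkt_value _ _ _ _ _ _ _ _ hvarphi2 htau2 phiN0 tauN0 dE t0E.
have t0ge0 : 0 <= t0.
  by rewrite t0E mulr_ge0 ?invr_ge0 ?mulr_ge0 ?subr_ge0 ?ltW.
have dle : - d <= beta0 1 0 by rewrite dE opprK.
have beta02 : beta0 2 0 = 0.
  apply/eqP; apply: contraFT (in_set0 (2 : 'I_3)) => nz.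
  by have : 2 \in active_set beta0 by [rewrite inE]; rewrite hactive hS0 !inE.
(* This is [beta0] shifted by (d, d, t0). By [dle] and [t0ge0] its entries are nonnegative, so its
   l1 norm is their sum. *)
pose bs : 'cV[R]_3 :=
  \col_j (if j == 2 then t0 else beta0 j 0 + d).
(* The shift identity, with the sum of the entries of [beta] bounded by its l1 norm. *)
have gap (beta : 'cV_3) : lasso_objective X beta0 lambda bs
    + diag_form rho C (beta 0 0 - bs 0 0) (beta 1 0 - bs 1 0) (beta 2 0 - bs 2 0)
    <= lasso_objective X beta0 lambda beta.
  rewrite /lasso_objective !normE !l1norm3 !mxE /= beta02 !subr0.
  have dK x : x + d - x = d by rewrite addrAC subrr add0r.
  have dB x y : x - (y + d) = x - y - d by rewrite opprD addrA.
  rewrite !dK !dB !(ger0_norm (x := _ + d)) ?(ger0_norm t0ge0); [|lra..].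
  have := shiftE (beta 0 0 - beta0 0 0) (beta 1 0 - beta0 1 0) (beta 2 0).
  have : 2 * lambda * (beta 0 0 + beta 1 0 + beta 2 0)
      <= 2 * lambda * (`|beta 0 0| + `|beta 1 0| + `|beta 2 0|).
    by rewrite ler_wpM2l ?lerD ?ler_norm //; lra.
  lra.
have bs_min : noiseless_lasso X beta0 lambda bs.
  move=> beta; apply: le_trans (gap beta).
  by rewrite lerDl diag_form_ge0.
split; first by exists bs.
move=> betas betas_min.
(* Comparing any minimiser with [bs] through [gap] makes the form of their difference nonpositive,
   so the two coincide. *)
have [e0 e1 e2] : [/\ betas 0 0 - bs 0 0 = 0, betas 1 0 - bs 1 0 = 0
    & betas 2 0 - bs 2 0 = 0].
  apply: diag_form_eq0 hrho01 hC2' _.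
  by have := gap betas; have := betas_min bs; lra.
rewrite -[X in _ = X - _]mulrA ratioE -valueE hS0 l1norm_subvecC01 normE.
move: e0 e1 e2; rewrite !mxE /= => e0 e1 e2.
have -> : betas 2 0 = t0 by lra.
rewrite beta02 subr0 ger0_norm //.
congr (diag_form _ _ _ _ _ + _); lra.
Qed.
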